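(* A function $g=\sum_{k=0}^{2n+1}\gamma_kB_k\in GS_2(\beta)$ is monotonic on $I$ if and only if its spline control polygon is monotonic, with the same sense of variation (that is, $g$ is nondecreasing, resp. nonincreasing, if and only if its spline control polygon is nondecreasing, resp. nonincreasing). Likewise, $g$ is convex on $I$ if and only if its spline control polygon is convex.
   Context: Setting. Let $n\ge 1$, $I=[a,b]$, $X=\{a=x_0<x_1<\dots<x_n=b\}$ a partition of $I$, $I_i=[x_{i-1},x_i]$, $h_i=x_i-x_{i-1}$, $m_i=\frac12(x_{i-1}+x_i)$ for $1\le i\le n$. Let $\beta=(\beta_1,\dots,\beta_n)$ with $\beta_i\in[-1,0[$ and $\theta_i=\frac12\frac{\beta_i}{\beta_i-1}\in\,]0,\frac14]$ (equivalently $\beta_i=\frac{-2\theta_i}{1-2\theta_i}$). The space $V(\beta_i)$ (generated by the Merrien subdivision algorithm) is the set of $C^1$ functions $f$ on $I_i$ such that for every dyadic subinterval $[u,v]$ of $I_i$ (i.e. every interval obtained from $I_i$ by repeated bisection, including $I_i$ itself), with $m=\frac12(u+v)$ and $h=v-u$, $$f(m)=\tfrac12\big(f(u)+f(v)-\theta_i h\,(f'(v)-f'(u))\big),\qquad f'(m)=\frac{1}{1-2\theta_i}\Big(\frac{f(v)-f(u)}{h}-2\theta_i\,\frac{f'(u)+f'(v)}{2}\Big).$$ It is known that for any prescribed values of $f,f'$ at the two endpoints of $I_i$ there is exactly one such $f$; so $\dim V(\beta_i)=4$. $GS_2(\beta)=GS_2(I,X,\beta)$ is the space of all $g\in C^1(I)$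 with $g|_{I_i}\in V(\beta_i)$ for all $1\le i\le n$ (generalized quadratic splines); it has dimension $2n+2$. The list of B-coefficients of $f\in V(\beta_i)$ on $I_i$ is $[\,f(x_{i-1}),\ f(x_{i-1})+\theta_ih_if'(x_{i-1}),\ f(x_i)-\theta_ih_if'(x_i),\ f(x_i)\,]$; it determines $f$ uniquely. For $1\le i\le n-1$ let $\omega_i=\frac{\theta_{i+1}h_{i+1}}{\theta_ih_i+\theta_{i+1}h_{i+1}}$. The generalized quadratic B-splines are the functions on $I$ defined by their B-coefficients as follows (all B-coefficients on subintervals not mentioned are zero). For $1\le i\le n-1$: $B_{2i}$ has lists $[0,0,1,\omega_i]$ on $I_i$ and $[\omega_i,0,0,0]$ on $I_{i+1}$; $B_{2i+1}$ has lists $[0,0,0,1-\omega_i]$ on $I_i$ and $[1-\omega_i,1,0,0]$ on $I_{i+1}$. At the ends: $B_0$ has list $[1,0,0,0]$ on $I_1$; $B_1$ has list $[0,1,0,0]$ on $I_1$; $B_{2n}$ has list $[0,0,1,0]$ on $I_n$; $B_{2n+1}$ has list $[0,0,0,1]$ on $I_n$. The family $\{B_k\}_{0\le k\le 2n+1}$ is a basis of $GS_2(\beta)$. Spline control polygon. Put $\xi_0=x_0$, $\xi_i=x_i-\theta_ih_i$ for $1\le i\le n$, $\eta_i=x_i+\theta_{i+1}h_{i+1}$ for $0\le i\le n-1$, $\eta_n=x_n$, so that $\xi_0<\eta_0<\xi_1<\eta_1<\dots<\xi_n<\eta_n$. The spline control polygon (SCP) of $g=\sum_{k=0}^{2n+1}\gamma_kB_k$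 is the graph of the continuous piecewise linear function on $I$ with consecutive vertices $\tilde\gamma_{2i}=(\xi_i,\gamma_{2i})$ and $\tilde\gamma_{2i+1}=(\eta_i,\gamma_{2i+1})$, $0\le i\le n$. Monotonic is understood in the weak sense. *)

(* Defs.v *)
From mathcomp Require Import all_boot all_order all_algebra.
From mathcomp Require Import all_classical all_reals all_analysis.

Set Implicit Arguments.
Unset Strict Implicit.
Unset Printing Implicit Defensive.

Import Order.TTheory GRing.Theory Num.Theory.
Import numFieldNormedType.Exports.

Local Open Scope classical_set_scope.
Local Open Scope ring_scope.

(* Functions on an interval are represented by total functions R -> R of which
   only the values on that interval matter.  In particular derivatives are
   taken within the interval, hence are one-sided at its endpoints. *)

Definition derivable_on (R : realType) (A : set R) (f : R -> R) (t : R) : Prop :=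
  cvg ((f s - f t) / (s - t) @[s --> within A t^']).

Definition derive_on (R : realType) (A : set R) (f : R -> R) (t : R) : R :=
  lim ((f s - f t) / (s - t) @[s --> within A t^']).

Definition C1_on (R : realType) (a b : R) (f : R -> R) : Prop :=
  {in `[a, b], forall t, derivable_on `[a, b] f t} /\
  {within `[a, b], continuous (derive_on `[a, b] f)}.

Inductive dyadic_subitv (R : realType) (a b : R) : R -> R -> Prop :=
| dyadic_full : dyadic_subitv a b a b
| dyadic_left u v : dyadic_subitv a b u v -> dyadic_subitv a b u ((u + v) / 2)
| dyadic_right u v : dyadic_subitv a b u v -> dyadic_subitv a b ((u + v) / 2) v.

(* The space V(beta_i) on [a, b], in terms of the parameter theta_i. *)
Definition merrien_space (R : realType) (theta a b : R) : set (R -> R) :=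
  [set f | C1_on a b f /\
    forall u v, dyadic_subitv a b u v ->
      let f' := derive_on `[a, b] f in
      let m := (u + v) / 2 in
      let h := v - u in
      f m = (f u + f v - theta * h * (f' v - f' u)) / 2 /\
      f' m = (1 - 2 * theta)^-1 *
             ((f v - f u) / h - 2 * theta * ((f' u + f' v) / 2))].

Definition bcoefs (R : realType) (theta a b : R) (f : R -> R) : seq R :=
  let f' := derive_on `[a, b] f in
  let h := b - a in
  [:: f a; f a + theta * h * f' a; f b - theta * h * f' b; f b].

(* Sequences indexed by 0..n or 1..n are functions on nat whose values outside
   that range are irrelevant: x_i (0 <= i <= n); beta_i, theta_i, h_i and the
   interval [x_(i-1), x_i] (1 <= i <= n). *)

Definition is_partition (R : realType) (a b : R) (n : nat) (x : nat -> R) : Prop :=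
  [/\ x 0%N = a, x n = b & forall i, (i < n)%N -> x i < x i.+1].

Definition step (R : realType) (x : nat -> R) (i : nat) : R := x i - x i.-1.

Definition theta (R : realType) (beta : nat -> R) (i : nat) : R :=
  2^-1 * (beta i / (beta i - 1)).

Definition GS2 (R : realType) (a b : R) (n : nat) (x beta : nat -> R) :
    set (R -> R) :=
  [set g | C1_on a b g /\
    forall i, (1 <= i <= n)%N ->
      merrien_space (theta beta i) (x i.-1) (x i) g].

Definition omega (R : realType) (x beta : nat -> R) (i : nat) : R :=
  theta beta i.+1 * step x i.+1 /
    (theta beta i * step x i + theta beta i.+1 * step x i.+1).

(* The list of B-coefficients of B_k on the i-th interval, 1 <= i <= n. *)
Definition bspline_coefs (R : realType) (n : nat) (x beta : nat -> R)
    (k i : nat) : seq R :=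
  let w := omega x beta k./2 in
  if k == 0%N then
    if i == 1%N then [:: 1; 0; 0; 0] else nseq 4 0
  else if k == 1%N then
    if i == 1%N then [:: 0; 1; 0; 0] else nseq 4 0
  else if k == n.*2 then
    if i == n then [:: 0; 0; 1; 0] else nseq 4 0
  else if k == n.*2.+1 then
    if i == n then [:: 0; 0; 0; 1] else nseq 4 0
  else if ~~ odd k then
    if i == k./2 then [:: 0; 0; 1; w]
    else if i == k./2.+1 then [:: w; 0; 0; 0] else nseq 4 0
  else
    if i == k./2 then [:: 0; 0; 0; 1 - w]
    else if i == k./2.+1 then [:: 1 - w; 1; 0; 0] else nseq 4 0.

(* Elements of V(beta_i) are determined by their B-coefficients, so this
   characterizes B_k uniquely on [x_0, x_n]. *)
Definition is_bspline (R : realType) (n : nat) (x beta : nat -> R) (k : nat)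
    (B : R -> R) : Prop :=
  forall i, (1 <= i <= n)%N ->
    merrien_space (theta beta i) (x i.-1) (x i) B /\
    bcoefs (theta beta i) (x i.-1) (x i) B = bspline_coefs n x beta k i.

Definition xi (R : realType) (x beta : nat -> R) (i : nat) : R :=
  if i == 0%N then x 0%N else x i - theta beta i * step x i.

Definition eta (R : realType) (n : nat) (x beta : nat -> R) (i : nat) : R :=
  if i == n then x n else x i + theta beta i.+1 * step x i.+1.

(* Piecewise linear function with the given consecutive vertices, listed by
   increasing abscissas. *)
Fixpoint polygonal (R : realType) (vs : seq (R * R)) (t : R) : R :=
  match vs with
  | [::] => 0
  | p :: vs' =>
    match vs' with
    | [::] => p.2
    | q :: _ =>
      if t <= q.1 then p.2 + (q.2 - p.2) * ((t - p.1) / (q.1 - p.1))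
      else polygonal vs' t
    end
  end.

Definition scp_vertices (R : realType) (n : nat) (x beta gamma : nat -> R) :
    seq (R * R) :=
  flatten [seq [:: (xi x beta i, gamma i.*2); (eta n x beta i, gamma i.*2.+1)]
          | i <- iota 0 n.+1].

Definition scp (R : realType) (n : nat) (x beta gamma : nat -> R) : R -> R :=
  polygonal (scp_vertices n x beta gamma).

Definition convex_on (R : realType) (a b : R) (f : R -> R) : Prop :=
  @convex_function R R^o `[a, b] f.

(* Main.v *)
Require Import Defs.
From mathcomp Require Import all_boot all_order all_algebra.
From mathcomp Require Import all_classical all_reals all_analysis.
From mathcomp Require Import zify ring lra.

Import Order.TTheory GRing.Theory Num.Theory.
Import numFieldNormedType.Exports.

Local Open Scope classical_set_scope.
Local Open Scope ring_scope.

Set Implicit Arguments.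
Unset Strict Implicit.
Unset Printing Implicit Defensive.

(** Number the vertices of the control polygon 0, ..., 2n+1 and let sigma_k be the
    slope of its k-th edge.  These slopes are values of g': the edge over x_i
    has slope g'(x_i), the edge inside the i-th interval has slope g'(m_i)
    ([scp_slopeE]).  Indeed, the vertices next to a knot lie on the tangent to g
    at that knot ([spline_gammaE]), and the Merrien formula for f'(m) is
    precisely the slope of the edge inside the interval.

    One bisection step stays inside the data: on a dyadic interval [u, v] of
    midpoint m, the derivative at the midpoint of [u, m] is a convex combination
    of f'(u) and f'(m), and symmetrically on [m, v] ([merrien_refine],
    [merrien_weight_bounds]).  Hence any bounds shared by f'(u), f'(m), f'(v)
    hold at all dyadic points, so by continuity of f' on all of [u, v]
    ([merrien_derive_in]), and the ordering f'(u) <= f'(m) <= f'(v) is inherited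
    by both halves, which makes f' nondecreasing ([merrien_derive_ndecr]).
    Gluing the intervals, g' takes its values in a closed interval if and only
    if all the sigma_k do, and g' is nondecreasing if and only if the sequence
    sigma_k is ([spline_derive_inP], [spline_derive_ndecrP]).

    It remains to express monotonicity and convexity by slopes, for g and for
    the polygon alike.  Both are conditions on secant slopes: nonnegative or
    nonpositive ([homo_leP], [nhomo_leP]), respectively nondecreasing from one
    interval to the next ([convex_onP]).  Secants of g are related to g' by the
    mean value theorem and by passing to the limit ([derive_on_secants_inP],
    [derive_on_secants_ndecrP]); secants of a polygon are convex combinations of
    its edge slopes ([polygon_secants_inP], [polygon_secants_ndecrP]). *)

(** * Secant slopes *)

Definition secant {R : realType} (f : R -> R) (s t : R) : R :=
  (f t - f s) / (t - s).

(** A set of slopes is used rather than a bound, so that one proof serves both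
    senses of variation. *)
Definition secants_in {R : realType} (A : set R) (a b : R) (f : R -> R) : Prop :=
  forall s t, a <= s -> s < t -> t <= b -> A (secant f s t).

Definition secants_ndecr {R : realType} (a b : R) (f : R -> R) : Prop :=
  forall s t u, a <= s -> s < t -> t < u -> u <= b ->
    secant f s t <= secant f t u.

Lemma secantC {R : realType} (f : R -> R) (s t : R) : secant f s t = secant f t s.
Proof. by rewrite /secant -[f t - f s]opprB -[t - s]opprB invrN mulrNN. Qed.

Lemma secantE {R : realType} (f : R -> R) (s t : R) :
  s < t -> f t - f s = secant f s t * (t - s).
Proof. by move=> st; rewrite /secant divfK// subr_eq0 gt_eqF. Qed.

Lemma is_interval_convex {R : realType} (A : set R) (p q w : R) :
  is_interval A -> A p -> A q -> 0 <= w <= 1 -> A (w * p + (1 - w) * q).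
Proof.
move=> iA Ap Aq /andP[w0 w1].
have [pq|/ltW qp] := leP p q.
  by apply: (iA p q) => //; apply/andP; split; nra.
by apply: (iA q p) => //; apply/andP; split; nra.
Qed.

(** The weight is the relative length of [s, r] in [s, t]. *)
Lemma secant_split {R : realType} (f : R -> R) (s r t : R) : s < r -> r < t ->
  exists2 w, 0 < w < 1 &
    secant f s t = w * secant f s r + (1 - w) * secant f r t.
Proof.
move=> sr rt; have st := lt_trans sr rt; exists ((r - s) / (t - s)).
  by rewrite divr_gt0 ?subr_gt0// ltr_pdivrMr ?subr_gt0// mul1r ltrD2r.
rewrite /secant; field.
by rewrite !subr_eq0 !gt_eqF.
Qed.

Lemma is_interval_secant_split {R : realType} (A : set R) (f : R -> R) (s r t : R) :
  is_interval A -> s < r -> r < t ->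
  A (secant f s r) -> A (secant f r t) -> A (secant f s t).
Proof.
move=> iA sr rt A1 A2; have [w /andP[w0 w1] ->] := secant_split f sr rt.
by apply: is_interval_convex => //; rewrite !ltW.
Qed.

Lemma homo_leP {R : realType} (a b : R) (f : R -> R) :
  {in `[a, b] &, {homo f : s t / s <= t}} <-> secants_in `[0, +oo[ a b f.
Proof.
split=> [mf s t as_ st tb|sf s t].
  rewrite /= in_itv/= andbT divr_ge0 ?subr_ge0 ?(ltW st)//.
  by apply: mf; rewrite ?in_itv/= ?as_ ?tb ?ltW// (le_lt_trans as_ st, lt_le_trans st tb).
rewrite !in_itv/= => /andP[as_ _] /andP[_ tb].
rewrite le_eqVlt => /predU1P[->//|st].
have /= := sf _ _ as_ st tb; rewrite in_itv/= andbT => h.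
by rewrite -subr_ge0 secantE// mulr_ge0// subr_ge0 ltW.
Qed.

Lemma nhomo_leP {R : realType} (a b : R) (f : R -> R) :
  {in `[a, b] &, {homo f : s t /~ s <= t}} <-> secants_in `]-oo, 0] a b f.
Proof.
split=> [mf s t as_ st tb|sf t s].
  rewrite /= in_itv/= mulr_le0_ge0 ?subr_le0 ?invr_ge0 ?subr_ge0 ?(ltW st)//.
  by apply: mf; rewrite ?in_itv/= ?as_ ?tb ?ltW// (le_lt_trans as_ st, lt_le_trans st tb).
rewrite !in_itv/= => /andP[_ tb] /andP[as_ _].
rewrite le_eqVlt => /predU1P[->//|st].
have /= := sf _ _ as_ st tb; rewrite in_itv/= => h.
by rewrite -subr_le0 secantE// mulr_le0_ge0// subr_ge0 ltW.
Qed.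

(** Unfolds the library's convex spaces, in which the weight is a bundled element
    of [0, 1], to the textbook inequality. *)
Lemma convex_onE {R : realType} (a b : R) (f : R -> R) :
  convex_on a b f <-> forall w s u, 0 <= w <= 1 -> a <= s <= b -> a <= u <= b ->
    f (w * s + (1 - w) * u) <= w * f s + (1 - w) * f u.
Proof.
split=> [cf w s u /andP[w0 w1] sI uI|cf w s u].
  by apply: (cf (Itv01 w0 w1)); rewrite inE/= in_itv.
by rewrite !inE/= !in_itv/=; apply: cf; rewrite ge0 le1.
Qed.

(** Cleared of denominators, the comparison of the secants over [s, t] and [t, u]
    is the convexity inequality at t. *)
Lemma convex_onP {R : realType} (a b : R) (f : R -> R) :
  convex_on a b f <-> secants_ndecr a b f.
Proof.
rewrite convex_onE; split=> [cf s t u as_ st tu ub|cf].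
  have su := lt_trans st tu.
  have w01 : 0 <= (u - t) / (u - s) <= 1.
    apply/andP; split; first by rewrite divr_ge0 ?subr_ge0 ?ltW.
    by rewrite ler_pdivrMr ?subr_gt0// mul1r lerD2l lerN2 ltW.
  have sI : a <= s <= b by rewrite as_ (le_trans (ltW su) ub).
  have uI : a <= u <= b by rewrite ub (le_trans as_ (ltW su)).
  have := cf _ _ _ w01 sI uI.
  have -> : (u - t) / (u - s) * s + (1 - (u - t) / (u - s)) * u = t.
    by field; rewrite subr_eq0 gt_eqF.
  have -> : (u - t) / (u - s) * f s + (1 - (u - t) / (u - s)) * f u =
            ((u - t) * f s + (t - s) * f u) / (u - s).
    by field; rewrite subr_eq0 gt_eqF.
  rewrite ler_pdivlMr ?subr_gt0// => h.
  rewrite /secant ler_pdivrMr ?subr_gt0// mulrAC ler_pdivlMr ?subr_gt0//.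
  lra.
have key s u w : a <= s -> s < u -> u <= b -> 0 < w < 1 ->
    f (w * s + (1 - w) * u) <= w * f s + (1 - w) * f u.
  move=> as_ su ub /andP[w0 w1]; set t := w * s + _.
  have st : s < t by rewrite /t; nra.
  have tu : t < u by rewrite /t; nra.
  have := cf s t u as_ st tu ub.
  rewrite /secant ler_pdivrMr ?subr_gt0// mulrAC ler_pdivlMr ?subr_gt0//.
  have -> : u - t = w * (u - s) by rewrite /t; ring.
  have -> : t - s = (1 - w) * (u - s) by rewrite /t; ring.
  rewrite !mulrA !ler_pM2r ?subr_gt0//; lra.
move=> w s u /andP[+ +] /andP[as_ sb] /andP[au ub].
rewrite le_eqVlt => /predU1P[<-|w0]; first by rewrite subr0 !mul0r !add0r !mul1r.
rewrite le_eqVlt => /predU1P[->|w1]; first by rewrite subrr !mul0r !addr0 !mul1r.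
have [su|us|->] := ltgtP s u.
- by apply: key => //; rewrite w0 w1.
- rewrite addrC [leRHS]addrC -{2 4}[w](subKr 1).
  by apply: key => //; rewrite subr_gt0 w1/= ltrBlDr ltrDl w0.
- by rewrite -!mulrDl addrC subrK !mul1r.
Qed.

(** * Polygons *)

(** [m] counts the edges, so that the vertices are those of index [j] to
    [j + m]. *)
Definition polygon {R : realType} (tau c : nat -> R) (j m : nat) : R -> R :=
  polygonal [seq (tau k, c k) | k <- iota j m.+1].

Definition polygon_slope {R : realType} (tau c : nat -> R) (k : nat) : R :=
  (c k.+1 - c k) / (tau k.+1 - tau k).

Lemma polygonS {R : realType} (tau c : nat -> R) (j m : nat) (t : R) :
  polygon tau c j m.+1 t =
  if t <= tau j.+1 then c j + polygon_slope tau c j * (t - tau j)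
  else polygon tau c j.+1 m t.
Proof. by rewrite /polygon /= /polygon_slope mulrA [in RHS]mulrAC. Qed.

Lemma polygon_node {R : realType} (tau c : nat -> R) (N j m : nat) :
  (forall k l, (k < l <= N)%N -> tau k < tau l) -> (j + m = N)%N ->
  forall k, (j <= k <= N)%N -> polygon tau c j m (tau k) = c k.
Proof.
move=> tauM; elim: m j => [|m IH] j jm k jkN.
  by have -> : k = j by lia.
rewrite polygonS; have jj : tau j < tau j.+1 by apply: tauM; lia.
have [->|kj] := eqVneq k j; first by rewrite (ltW jj) subrr mulr0 addr0.
have [->|kj1] := eqVneq k j.+1.
  by rewrite lexx /polygon_slope divfK ?subr_eq0 ?gt_eqF// addrC subrK.
rewrite leNgt tauM /=; last by lia.
by apply: IH; lia.
Qed.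

(** This drives inductions on the number of edges.  The second part includes
    s = tau j.+1, where the test in [polygonal] still selects the first edge:
    both polygons pass through that vertex. *)
Lemma polygon_head {R : realType} (tau c : nat -> R) (N j m : nat) :
  (forall k l, (k < l <= N)%N -> tau k < tau l) -> (j + m.+1 = N)%N ->
  (forall s t, s < t -> t <= tau j.+1 ->
     secant (polygon tau c j m.+1) s t = polygon_slope tau c j) /\
  (forall s t, tau j.+1 <= s -> s < t ->
     secant (polygon tau c j m.+1) s t = secant (polygon tau c j.+1 m) s t).
Proof.
move=> tauM jm; split=> s t.
  move=> st tj; rewrite /secant !polygonS tj (le_trans (ltW st) tj).
  by field; rewrite subr_eq0 gt_eqF.
move=> js st; suff E r : tau j.+1 <= r ->
    polygon tau c j m.+1 r = polygon tau c j.+1 m r.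
  by rewrite /secant !E// (le_trans js (ltW st)).
rewrite le_eqVlt => /predU1P[<-|jr]; last by rewrite polygonS leNgt jr.
by rewrite !(@polygon_node _ _ _ N)//; lia.
Qed.

(** A secant that straddles the second vertex is a convex combination of the
    first slope and of a secant of the remaining polygon. *)
Lemma polygon_secants_in {R : realType} (A : set R) (tau c : nat -> R)
    (N j m : nat) :
  is_interval A -> (forall k l, (k < l <= N)%N -> tau k < tau l) ->
  (j + m = N)%N -> (forall k, (j <= k < N)%N -> A (polygon_slope tau c k)) ->
  secants_in A (tau j) (tau N) (polygon tau c j m).
Proof.
move=> iA tauM; elim: m j => [|m IH] j jm sA s t js st tN.
  move: jm; rewrite addn0 => jm; subst j.
  by have := lt_le_trans (le_lt_trans js st) tN; rewrite ltxx.
have [hd tl] := polygon_head c tauM jm.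
have Aj : A (polygon_slope tau c j) by apply: sA; lia.
have IHj : secants_in A (tau j.+1) (tau N) (polygon tau c j.+1 m).
  by apply: IH => [|k kN]; [|apply: sA]; lia.
have [tj|jt] := leP t (tau j.+1); first by rewrite hd.
have [sj|sj] := ltP s (tau j.+1); last by rewrite tl//; exact: IHj.
by apply: (@is_interval_secant_split _ _ _ _ (tau j.+1)) => //;
  [rewrite hd|rewrite tl//; apply: IHj].
Qed.

Lemma nodes_le {R : realType} (tau : nat -> R) (N : nat) :
  (forall k l, (k < l <= N)%N -> tau k < tau l) ->
  forall k l, (k <= l <= N)%N -> tau k <= tau l.
Proof.
move=> tauM k l /andP[]; rewrite leq_eqVlt => /predU1P[->//|kl lN].
by apply/ltW/tauM; rewrite kl.
Qed.

Lemma polygon_secants_inP {R : realType} (A : set R) (tau c : nat -> R) (N : nat) :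
  is_interval A -> (forall k l, (k < l <= N)%N -> tau k < tau l) ->
  secants_in A (tau 0%N) (tau N) (polygon tau c 0 N) <->
  (forall k, (k < N)%N -> A (polygon_slope tau c k)).
Proof.
move=> iA tauM; split=> [sA k kN|sA]; last exact: polygon_secants_in.
have := sA (tau k) (tau k.+1); rewrite /secant !(@polygon_node _ _ _ N)//; try lia.
by apply; [apply: (nodes_le tauM)|apply: tauM|apply: (nodes_le tauM)]; lia.
Qed.

Lemma polygon_secants_ndecrP {R : realType} (tau c : nat -> R) (N : nat) :
  (forall k l, (k < l <= N)%N -> tau k < tau l) ->
  secants_ndecr (tau 0%N) (tau N) (polygon tau c 0 N) <->
  (forall k, (k.+1 < N)%N -> polygon_slope tau c k <= polygon_slope tau c k.+1).
Proof.
move=> tauM; split=> [sA k kN|sA].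
  have := sA (tau k) (tau k.+1) (tau k.+2).
  rewrite /secant !(@polygon_node _ _ _ N)//; try lia.
  by apply; [apply: (nodes_le tauM)|apply: tauM|apply: tauM|
    apply: (nodes_le tauM)]; lia.
have {}sA k l : (k <= l < N)%N -> polygon_slope tau c k <= polygon_slope tau c l.
  elim: l => [|l IHl] klN; first by have -> : k = 0%N by lia.
  have [->//|kl] := eqVneq k l.+1.
  by apply: (le_trans (IHl _) (sA _ _)); lia.
suff H m j : (j + m = N)%N ->
    secants_ndecr (tau j) (tau N) (polygon tau c j m) by exact: H.
elim: m j => [|m IH] j jm s t u js st tu uN.
  move: jm; rewrite addn0 => jm; subst j.
  by have := lt_le_trans (le_lt_trans js (lt_trans st tu)) uN; rewrite ltxx.
have [hd tl] := polygon_head c tauM jm.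
have {}IH : secants_ndecr (tau j.+1) (tau N) (polygon tau c j.+1 m) by apply: IH; lia.
have iA : is_interval (`[polygon_slope tau c j, +oo[%classic : set R) :=
  @interval_is_interval _ _.
have [tj|jt] := leP t (tau j.+1).
  have := @polygon_secants_in _ _ _ c _ _ _ iA tauM jm; rewrite [leLHS]hd// => h.
  have := h _ t u; rewrite /= in_itv/= andbT; apply => //.
    by move=> k kN; rewrite /= in_itv/= andbT; apply: sA; lia.
  exact: le_trans js (ltW st).
rewrite [leRHS]tl// ?(ltW jt)//.
have [sj|sj] := ltP s (tau j.+1); last by rewrite tl//; apply: IH.
(* The secant over [s, t] is a mean of the first slope, which no later slope
   goes below, and of a secant to which the induction hypothesis applies. *)
have [w /andP[w0 w1] ->] := secant_split (polygon tau c j m.+1) sj jt.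
rewrite hd// tl//.
have h2 := IH _ _ _ (lexx _) jt tu uN.
have : (`[polygon_slope tau c j, +oo[%classic : set R)
         (secant (polygon tau c j.+1 m) (tau j.+1) t).
  apply: (@polygon_secants_in _ _ _ c _ _ _ iA tauM) => //; first lia.
    by move=> k kN; rewrite /= in_itv/= andbT; apply: sA; lia.
  exact: le_trans (ltW tu) uN.
rewrite /= in_itv/= andbT => h1.
apply: le_trans h2; nra.
Qed.

(** * Derivatives within an interval *)

(** No point of a nondegenerate interval is isolated in it, so the limits that
    define [derive_on] are unique. *)
Lemma within_itv_dnbhs_proper {R : realType} (a b t : R) : a < b -> t \in `[a, b] ->
  ProperFilter (within `[a, b] t^').
Proof.
move=> ab; rewrite in_itv/= => /andP[at_ tb]; apply: Build_ProperFilter.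
move=> /nbhs_ballP[e /= e0 he].
have [tb'|bt] := ltP t b.
  pose s := Num.min b (t + e / 2).
  have ts : t < s by rewrite lt_min tb' ltrDl divr_gt0.
  apply: (he s); rewrite ?gt_eqF//=; last first.
    by rewrite in_itv/= ge_min lexx (le_trans at_ (ltW ts)).
  rewrite /ball/= distrC ger0_norm ?subr_ge0 ?ltW// ltrBlDl gt_min.
  by apply/orP; right; rewrite ltrD2l; lra.
have {bt} at' : a < t by rewrite (lt_le_trans ab bt).
pose s := Num.max a (t - e / 2).
have ts : s < t by rewrite gt_max at' ltrBlDr ltrDl divr_gt0.
apply: (he s); rewrite ?lt_eqF//=; last first.
  by rewrite in_itv/= le_max lexx (le_trans (ltW ts) tb).
rewrite /ball/= ger0_norm ?subr_ge0 ?ltW// ltrBlDl -ltrBlDr lt_max.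
by apply/orP; right; rewrite ltrD2l; lra.
Qed.

Lemma derive_on_val {R : realType} (a b t l : R) (f : R -> R) :
  a < b -> t \in `[a, b] ->
  (f s - f t) / (s - t) @[s --> within `[a, b] t^'] --> l ->
  derive_on `[a, b] f t = l.
Proof.
move=> ab tab; have FF := within_itv_dnbhs_proper ab tab.
exact: cvg_lim.
Qed.

Lemma derive_on_sub {R : realType} (a b c d t : R) (f : R -> R) :
  c < d -> a <= c -> d <= b -> t \in `[c, d] -> derivable_on `[a, b] f t ->
  (f s - f t) / (s - t) @[s --> within `[c, d] t^'] --> derive_on `[a, b] f t.
Proof.
move=> cd ac db tcd df; apply: cvg_trans df; apply: cvg_app.
apply: within_subset => s /=; rewrite !in_itv/= => /andP[cs sd].
by rewrite (le_trans ac cs) (le_trans sd db).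
Qed.

Lemma derive_on_subE {R : realType} (a b c d t : R) (f : R -> R) :
  c < d -> a <= c -> d <= b -> t \in `[c, d] -> derivable_on `[a, b] f t ->
  derive_on `[c, d] f t = derive_on `[a, b] f t.
Proof. by move=> cd ac db tcd df; apply: derive_on_val => //; exact: derive_on_sub. Qed.

Lemma derive_on_in {R : realType} (A : set R) (a b t : R) (f : R -> R) :
  closed A -> a < b -> t \in `[a, b] -> derivable_on `[a, b] f t ->
  (forall s, s \in `[a, b] -> s != t -> A (secant f t s)) ->
  A (derive_on `[a, b] f t).
Proof.
move=> cA ab tab df sA; have FF := within_itv_dnbhs_proper ab tab.
apply: (closed_cvg A cA _ _ df); near=> s.
apply: sA; first by near: s; apply: withinT.
by near: s; apply: (filterS _ (nbhs_dnbhs_neq t)) => s st _.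
Unshelve. all: by end_near.
Qed.

Lemma derive_on_sum {R : realType} (a b t : R) (f : R -> R) (m : nat) (c : nat -> R)
    (F : nat -> R -> R) :
  a < b -> t \in `[a, b] ->
  (forall s, s \in `[a, b] -> f s = \sum_(k < m) c k * F k s) ->
  (forall k, (k < m)%N -> derivable_on `[a, b] (F k) t) ->
  derive_on `[a, b] f t = \sum_(k < m) c k * derive_on `[a, b] (F k) t.
Proof.
move=> ab tab fE dF; apply: derive_on_val => //.
have FF := within_itv_dnbhs_proper ab tab.
apply: (@cvg_trans _ ((\sum_(k < m) c k * secant (F k) t s) @[s --> within `[a, b] t^'])).
  apply: near_eq_cvg; near=> s.
  have sab : s \in `[a, b] by near: s; exact: near_withinT.
  rewrite !fE// -sumrB mulr_suml; apply: eq_bigr => k _.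
  by rewrite -mulrBr -mulrA.
apply: cvg_big => [|k _]; first exact: add_continuous.
apply: cvgM; [exact: cvg_cst|exact: dF].
Unshelve. all: by end_near.
Qed.

(** From f s = f t + (f s - f t) / (s - t) * (s - t) by passing to the limit. *)
Lemma derivable_on_continuous {R : realType} (a b : R) (f : R -> R) :
  {in `[a, b], forall t, derivable_on `[a, b] f t} ->
  {within `[a, b], continuous f}.
Proof.
move=> df; apply/subspace_continuousP => t tab.
have dft := df t tab.
have h : (f t + (f s - f t) / (s - t) * (s - t)) @[s --> within `[a, b] t^']
    --> f t + derive_on `[a, b] f t * (t - t).
  apply: cvgD; first exact: cvg_cst.
  apply: cvgM => //; apply: cvgB; last exact: cvg_cst.
  apply: cvg_within_filter; apply: cvg_within_filter; exact: cvg_id.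
rewrite subrr mulr0 addr0 in h.
move=> P Pft; have /= := h P Pft; rewrite /nbhs/= /within/=.
move/nbhs_ballP => [e e0 he]; apply/nbhs_ballP; exists e => // s st sab.
have [->|st'] := eqVneq s t; first exact: nbhs_singleton.
have := he s st st' sab.
by rewrite divfK ?subr_eq0// addrC subrK.
Qed.

Lemma derive_on_is_derive {R : realType} (a b t : R) (f : R -> R) :
  t \in `]a, b[ -> derivable_on `[a, b] f t ->
  is_derive t 1 f (derive_on `[a, b] f t).
Proof.
move=> tab df.
have h : h^-1 *: ((f \o shift t) (h *: 1) - f t) @[h --> 0^'] --> derive_on `[a, b] f t.
  move=> P Pft; have /= := df P Pft; rewrite /nbhs/= /within/=.
  move/nbhs_ballP => [e e0 he].
  have /nbhs_ballP[e' e'0 he'] := near_in_itvoo tab.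
  apply/nbhs_ballP; exists (Num.min e e'); first by rewrite /= lt_min e0 e'0.
  move=> s; rewrite /ball/= sub0r normrN lt_min => /andP[se se'] s0.
  have := he (s + t); rewrite /= addrK [s%:A]mulr1 [_^-1 *: _]mulrC; apply.
  - by rewrite /ball/= opprD addrCA subrr addr0 normrN.
  - by rewrite -subr_eq0 addrK.
  - apply: subset_itv_oo_cc; apply: he'.
    by rewrite /ball/= opprD addrCA subrr addr0 normrN.
apply: DeriveDef; first by apply/cvg_ex; eexists; exact: h.
exact: cvg_lim h.
Qed.

Lemma derive_on_mvt {R : realType} (a b s t : R) (f : R -> R) :
  {in `[a, b], forall t, derivable_on `[a, b] f t} ->
  a <= s -> s < t -> t <= b ->
  exists2 r, s < r < t & secant f s t = derive_on `[a, b] f r.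
Proof.
move=> df as_ st tb.
have sub : `[s, t] `<=` `[a, b].
  by apply: subset_itv; rewrite bnd_simp.
have [r rst E] : exists2 r, r \in `]s, t[ &
    f t - f s = derive_on `[a, b] f r * (t - s).
  apply: MVT => // [r|]; last first.
    apply: continuous_subspaceW sub _; exact: derivable_on_continuous.
  move=> rst; apply: derive_on_is_derive.
    by apply: subset_itvW rst.
  by apply: df; apply: sub; apply: subset_itv_oo_cc.
exists r; first by move: rst; rewrite in_itv.
by rewrite /secant E mulfK// subr_eq0 gt_eqF.
Qed.

(** Derivatives are limits of secants, and secants are derivatives at an
    intermediate point. *)
Lemma derive_on_secants_inP {R : realType} (A : set R) (a b : R) (f : R -> R) :
  closed A -> a < b -> {in `[a, b], forall t, derivable_on `[a, b] f t} ->
  secants_in A a b f <-> (forall t, t \in `[a, b] -> A (derive_on `[a, b] f t)).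
Proof.
move=> cA ab df; split=> [sA t tab|dA s t as_ st tb].
  apply: derive_on_in => // [|s sab]; first exact: df.
  move: tab sab; rewrite !in_itv/= => /andP[at_ tb] /andP[as_ sb].
  by rewrite neq_lt => /orP[ts|ts]; [rewrite secantC|]; apply: sA.
have [r /andP[sr rt] ->] := derive_on_mvt df as_ st tb.
by apply: dA; rewrite in_itv/= (le_trans as_ (ltW sr)) (le_trans (ltW rt) tb).
Qed.

Lemma derive_on_secants_ndecrP {R : realType} (a b : R) (f : R -> R) :
  {in `[a, b], forall t, derivable_on `[a, b] f t} ->
  secants_ndecr a b f <->
  (forall s t, a <= s -> s < t -> t <= b ->
     derive_on `[a, b] f s <= derive_on `[a, b] f t).
Proof.
move=> df; split=> [sA s t as_ st tb|dA s t u as_ st tu ub]; last first.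
  have [p /andP[sp pt] ->] := derive_on_mvt df as_ st (le_trans (ltW tu) ub).
  have [q /andP[tq qu] ->] := derive_on_mvt df (le_trans as_ (ltW st)) tu ub.
  by apply: dA; rewrite ?(le_trans as_ (ltW sp)) ?(le_trans (ltW qu) ub)//
    (lt_trans pt tq).
have sst : s \in `[s, t] by rewrite in_itv/= lexx ltW.
have tst : t \in `[s, t] by rewrite in_itv/= lexx ltW.
have dst : {in `[s, t], forall r, derivable_on `[a, b] f r}.
  by move=> r; rewrite in_itv/= => /andP[sr rt]; apply: df;
    rewrite in_itv/= (le_trans as_ sr) (le_trans rt tb).
have dst' : {in `[s, t], forall r, derivable_on `[s, t] f r}.
  by move=> r rst; apply/cvg_ex; eexists; apply: derive_on_sub (dst r rst).
rewrite -!(@derive_on_subE _ a b s t)//; try exact: dst.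
(* The secant of f over [s, t] separates the two derivatives. *)
apply: (@le_trans _ _ (secant f s t)).
  suff : (`]-oo, secant f s t]%classic : set R) (derive_on `[s, t] f s).
    by rewrite /= in_itv.
  apply: derive_on_in => //; [exact: dst'|move=> r].
  rewrite in_itv/= => /andP[sr rt] rs; rewrite in_itv/=.
  have {}sr : s < r by rewrite lt_neqAle eq_sym rs.
  move: rt; rewrite [r <= t]le_eqVlt => /predU1P[->//|rt].
  have [w /andP[w0 w1] ->] := secant_split f sr rt.
  have := sA s r t as_ sr rt tb; nra.
suff : (`[secant f s t, +oo[%classic : set R) (derive_on `[s, t] f t).
  by rewrite /= in_itv/= andbT.
apply: derive_on_in => //; [exact: rray_closed|exact: dst'|move=> r].
rewrite in_itv/= => /andP[sr rt] rs; rewrite in_itv/= andbT [secant f t r]secantC.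
have {}rt : r < t by rewrite lt_neqAle rs.
move: sr; rewrite [s <= r]le_eqVlt => /predU1P[<-//|sr].
have [w /andP[w0 w1] ->] := secant_split f sr rt.
have := sA s r t as_ sr rt tb; nra.
Qed.

(** * The subdivision scheme on one interval *)

Lemma div_expn2_lt {R : realType} (h e : R) : 0 < e -> exists k, h / 2 ^+ k < e.
Proof.
move=> e0; have h1 : 0 < `|h| + 1 by rewrite ltr_wpDl.
have [k _ /(_ k (leqnn k))/=] :=
  near_infty_natSinv_expn_lt (PosNum (divr_gt0 e0 h1)).
rewrite ltr_pdivlMr// mulrAC mul1r => hk; exists k; apply: le_lt_trans hk.
by rewrite ler_pM2r ?invr_gt0 ?exprn_gt0// (le_trans (ler_norm h))// lerDl.
Qed.

Lemma dyadic_subitv_bounds {R : realType} (a b u v : R) :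
  a < b -> dyadic_subitv a b u v -> [/\ a <= u, u < v & v <= b].
Proof.
by move=> ab; elim => {u v} [|u v _ [au uv vb]|u v _ [au uv vb]]; split; lra.
Qed.

(** Substitute the formula for f (m) into the formula for the derivative at the
    midpoint of each half, then eliminate f (v) - f (u) by the formula for
    f' (m). *)
Lemma merrien_refine {R : realType} (th a b u v : R) (f : R -> R) :
  let f' := derive_on `[a, b] f in let m := (u + v) / 2 in
  0 < th <= 4^-1 -> a < b -> merrien_space th a b f -> dyadic_subitv a b u v ->
  f' ((u + m) / 2) =
    th / (1 - 2 * th) * f' u + (1 - th / (1 - 2 * th)) * f' m /\
  f' ((m + v) / 2) =
    th / (1 - 2 * th) * f' v + (1 - th / (1 - 2 * th)) * f' m.
Proof.
move=> f' m /andP[th0 th4] ab [_ fM] duv.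
have [_ uv _] := dyadic_subitv_bounds ab duv.
have [fm f'm] := fM _ _ duv; rewrite -/f' -/m in fm f'm.
have [_ f'l] := fM _ _ (dyadic_left duv); rewrite -/f' -/m in f'l.
have [_ f'r] := fM _ _ (dyadic_right duv); rewrite -/f' -/m in f'r.
have th1 : 1 - 2 * th != 0 by apply: lt0r_neq0; lra.
have h0 : v - u != 0 by rewrite subr_eq0 gt_eqF.
have mu : m - u = (v - u) / 2 by rewrite /m; field.
have vm : v - m = (v - u) / 2 by rewrite /m; field.
have fuv : f v - f u =
    (v - u) * ((1 - 2 * th) * f' m + 2 * th * ((f' u + f' v) / 2)).
  by rewrite f'm; field; apply/andP.
have fv : f v = f u +
    (v - u) * ((1 - 2 * th) * f' m + 2 * th * ((f' u + f' v) / 2)).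
  by rewrite -fuv; ring.
clear f'm fuv.
by split; rewrite ?f'l ?f'r fm ?mu ?vm fv; field; rewrite ?th1 ?h0.
Qed.

(** The weight of [merrien_refine] and its complement (1 - 3 th) / (1 - 2 th) are
    nonnegative: a refined derivative lies between its two neighbours. *)
Lemma merrien_weight_bounds {R : realType} (th : R) :
  0 < th <= 4^-1 -> 0 <= th / (1 - 2 * th) <= 1.
Proof.
move=> /andP[th0 th4]; apply/andP; split; first by rewrite divr_ge0//; lra.
rewrite ler_pdivrMr; lra.
Qed.

(** Any property that passes from a dyadic interval to its halves is met on
    dyadic intervals around [t] that are as short as desired. *)
Lemma dyadic_subitv_approx {R : realType} (a b : R) (P : R -> R -> Prop)
    (u v t : R) (k : nat) :
  (forall u v, dyadic_subitv a b u v -> P u v ->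
     P u ((u + v) / 2) /\ P ((u + v) / 2) v) ->
  dyadic_subitv a b u v -> P u v -> u <= t <= v ->
  exists u' v', [/\ dyadic_subitv a b u' v', P u' v', u' <= t <= v' &
    v' - u' = (v - u) / 2 ^+ k].
Proof.
move=> PS duv Puv utv; elim: k => [|k [p [q [dpq Ppq /andP[pt tq] pqE]]]].
  by exists u, v; rewrite expr0 divr1.
have [Pl Pr] := PS _ _ dpq Ppq.
have [tm|mt] := leP t ((p + q) / 2).
  exists p, ((p + q) / 2); split; rewrite ?pt//; first exact: dyadic_left.
  by rewrite exprSr invfM mulrA -pqE; field.
exists ((p + q) / 2), q; split; rewrite ?tq ?(ltW mt)//; first exact: dyadic_right.
by rewrite exprSr invfM mulrA -pqE; field.
Qed.

(** By [merrien_refine], membership in A of the derivatives at both ends and at the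
    midpoint is inherited by both halves; the left ends of shrinking dyadic
    intervals around t then converge to t. *)
Lemma merrien_derive_in {R : realType} (A : set R) (th a b u v : R) (f : R -> R) :
  let f' := derive_on `[a, b] f in
  is_interval A -> closed A ->
  0 < th <= 4^-1 -> a < b -> merrien_space th a b f -> dyadic_subitv a b u v ->
  A (f' u) -> A (f' ((u + v) / 2)) -> A (f' v) ->
  forall t, u <= t <= v -> A (f' t).
Proof.
move=> f' iA cA th4 ab fV duv Au Am Av t utv.
pose P u v := [/\ A (f' u), A (f' ((u + v) / 2)) & A (f' v)].
have PS p q : dyadic_subitv a b p q -> P p q ->
    P p ((p + q) / 2) /\ P ((p + q) / 2) q.
  move=> dpq [Ap Apq Aq]; have w01 := merrien_weight_bounds th4.
  have [El Er] := merrien_refine th4 ab fV dpq.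
  by split; split=> //; rewrite /f' ?El ?Er; exact: is_interval_convex.
have Puv : P u v by split.
have [au uv vb] := dyadic_subitv_bounds ab duv.
have tab : t \in `[a, b].
  move: utv => /andP[ut tv].
  by rewrite in_itv/= (le_trans au ut) (le_trans tv vb).
apply: cA => U /=.
have [_ /subspace_continuousP/(_ t tab) f'C] := fV.1.
move=> /f'C; rewrite /nbhs/= => /nbhs_ballP[e /= e0 he].
have [k ke] := div_expn2_lt (v - u) e0.
have [p [q [dpq [Ap _ _] /andP[pt tq] pqE]]] := dyadic_subitv_approx k PS duv Puv utv.
have [ap pq qb] := dyadic_subitv_bounds ab dpq.
exists (f' p); split=> //; apply: he; last first.
  by rewrite /= in_itv/= ap (le_trans (ltW pq) qb).
rewrite /ball/= ger0_norm ?subr_ge0//; apply: le_lt_trans ke.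
by rewrite -pqE lerD2r.
Qed.

(** The ordering of the three derivatives is inherited by both halves.  Bisecting
    a dyadic interval that contains s and t until its midpoint separates them, the
    derivative at the midpoint separates f' s and f' t by [merrien_derive_in]. *)
Lemma merrien_derive_ndecr {R : realType} (th a b : R) (f : R -> R) :
  let f' := derive_on `[a, b] f in
  0 < th <= 4^-1 -> a < b -> merrien_space th a b f ->
  f' a <= f' ((a + b) / 2) <= f' b ->
  forall s t, a <= s -> s < t -> t <= b -> f' s <= f' t.
Proof.
move=> f' th4 ab fV fab s t as_ st tb.
pose P u v := f' u <= f' ((u + v) / 2) <= f' v.
have [/andP[w0 w1]] := merrien_weight_bounds th4.
set w := th / (1 - 2 * th) in w0 w1.
have PS u v : dyadic_subitv a b u v -> P u v ->
    P u ((u + v) / 2) /\ P ((u + v) / 2) v.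
  move=> duv /andP[um mv]; have [El Er] := merrien_refine th4 ab fV duv.
  by rewrite /P /f' El Er -/f' -/w; split; apply/andP; split; nra.
have [k /ltW kst] : exists k, (b - a) / 2 ^+ k < t - s.
  by apply: div_expn2_lt; rewrite subr_gt0.
have bnd u v : dyadic_subitv a b u v -> P u v ->
    forall r, u <= r <= v -> f' u <= f' r <= f' v.
  move=> duv /andP[um mv] r urv.
  suff : (`[f' u, f' v]%classic : set R) (f' r) by rewrite /= in_itv.
  apply: (merrien_derive_in _ _ th4 ab fV duv _ _ _ urv); rewrite -/f' /=.
  - exact: interval_is_interval.
  - exact: interval_closed.
  - by rewrite in_itv/= lexx (le_trans um mv).
  - by rewrite in_itv/= um mv.
  - by rewrite in_itv/= lexx (le_trans um mv).
suff H u v : dyadic_subitv a b u v -> P u v -> u <= s -> t <= v ->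
    v - u <= (t - s) * 2 ^+ k -> f' s <= f' t.
  apply: (H a b) => //; first exact: dyadic_full.
  by rewrite -ler_pdivrMr ?exprn_gt0.
elim: k {kst} u v => [|k IH] u v duv Puv us tv.
  rewrite expr0 mulr1 => h.
  have -> : s = u by lra.
  have -> : t = v by lra.
  by have /andP[um mv] := Puv; exact: le_trans mv.
rewrite exprSr mulrA => h.
have [Pl Pr] := PS _ _ duv Puv.
have [tm|mt] := leP t ((u + v) / 2).
  by apply: (IH _ _ (dyadic_left duv) Pl) => //; lra.
have [ms|sm] := leP ((u + v) / 2) s.
  by apply: (IH _ _ (dyadic_right duv) Pr) => //; lra.
apply: (@le_trans _ _ (f' ((u + v) / 2))).
  have us' : u <= s <= (u + v) / 2 by rewrite us ltW.
  by have /andP[] := bnd _ _ (dyadic_left duv) Pl s us'.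
have tv' : (u + v) / 2 <= t <= v by rewrite tv ltW.
by have /andP[] := bnd _ _ (dyadic_right duv) Pr t tv'.
Qed.

(** * Generalized splines and their control polygons *)

Lemma theta_bounds {R : realType} (beta : nat -> R) (i : nat) :
  -1 <= beta i < 0 -> 0 < theta beta i <= 4^-1.
Proof.
move=> /andP[b1 b0].
have -> : theta beta i = - beta i / (2 * (1 - beta i)).
  have h1 : beta i - 1 != 0 by rewrite subr_eq0 lt_eqF//; lra.
  have h2 : 1 - beta i != 0 by rewrite subr_eq0 gt_eqF//; lra.
  by rewrite /theta; field; rewrite ?h1 ?h2.
have d0 : 0 < 2 * (1 - beta i) by lra.
apply/andP; split; first by rewrite divr_gt0//; lra.
by rewrite ler_pdivrMr//; lra.
Qed.

Lemma nodes_lt {R : realType} (tau : nat -> R) (N : nat) :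
  (forall k, (k < N)%N -> tau k < tau k.+1) ->
  forall k l, (k < l <= N)%N -> tau k < tau l.
Proof.
move=> tauS k; elim=> [|l IH] klN; first lia.
have [->|kl] := eqVneq k l; first by apply: tauS; lia.
by apply: (lt_trans (IH _)); [|apply: tauS]; lia.
Qed.

Lemma nodes_cover {R : realType} (x : nat -> R) (n : nat) (t : R) :
  (1 <= n)%N -> x 0%N <= t <= x n ->
  exists2 i, (i < n)%N & x i <= t <= x i.+1.
Proof.
elim: n => [//|[|n] IH] _ /andP[x0t tn]; first by exists 0%N; rewrite ?x0t.
have [xt|tx] := leP (x n.+1) t; first by exists n.+1; rewrite ?xt.
have [||i ni xi] := IH; rewrite ?x0t ?ltW//.
by exists i => //; exact: ltnW.
Qed.

Lemma partition_le {R : realType} (a b : R) (n : nat) (x : nat -> R) :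
  is_partition a b n x ->
  forall i, (i < n)%N -> [/\ x i < x i.+1, a <= x i & x i.+1 <= b].
Proof.
move=> [<- <- xS] i ni; have xM := nodes_le (nodes_lt xS).
by split; [exact: xS|apply: xM|apply: xM]; lia.
Qed.

(** B-coefficients are linear in the function, which only matters on [u, v]. *)
Lemma bcoefs_sum {R : realType} (th u v : R) (f : R -> R) (m : nat)
    (c : nat -> R) (F : nat -> R -> R) (j : nat) :
  u < v -> (forall s, s \in `[u, v] -> f s = \sum_(k < m) c k * F k s) ->
  (forall k, (k < m)%N -> {in `[u, v], forall s, derivable_on `[u, v] (F k) s}) ->
  nth 0 (bcoefs th u v f) j = \sum_(k < m) c k * nth 0 (bcoefs th u v (F k)) j.
Proof.
move=> uv fE dF.
have uI : u \in `[u, v] by rewrite in_itv/= lexx ltW.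
have vI : v \in `[u, v] by rewrite in_itv/= lexx ltW.
have fu := derive_on_sum uv uI fE (fun k km => dF k km u uI).
have fv := derive_on_sum uv vI fE (fun k km => dF k km v vI).
case: j => [|[|[|[|j]]]] /=; rewrite ?fE ?fu ?fv //.
- by rewrite mulr_sumr -big_split/=; apply: eq_bigr => k _; ring.
- by rewrite mulr_sumr -sumrB/=; apply: eq_bigr => k _; ring.
- by rewrite nth_nil big1// => k _; rewrite mulr0.
Qed.

(** Each inner B-coefficient on an interval belongs to exactly one B-spline; only
    the outer two involve the weights omega. *)
Lemma bspline_coefs_inner {R : realType} (n : nat) (x beta : nat -> R) (k i : nat) :
  (i < n)%N -> (k < n.*2.+2)%N ->
  nth 0 (bspline_coefs n x beta k i.+1) 1 = (k == i.*2.+1)%:R /\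
  nth 0 (bspline_coefs n x beta k i.+1) 2 = (k == i.+1.*2)%:R.
Proof.
move=> ni kn; rewrite /bspline_coefs.
case: (k =P i.*2.+1) => k1; case: (k =P i.+1.*2) => k2; rewrite /=;
  do ?[case: eqP => ? /=]; do ?[case: ifP => ? /=]; do ?[case: eqP => ? /=];
  by [|exfalso; lia].
Qed.

Lemma bspline_coefs_ends {R : realType} (n : nat) (x beta : nat -> R) (k : nat) :
  (1 <= n)%N -> (k < n.*2.+2)%N ->
  nth 0 (bspline_coefs n x beta k 1) 0 = (k == 0)%:R /\
  nth 0 (bspline_coefs n x beta k n) 3 = (k == n.*2.+1)%:R.
Proof.
move=> n1 kn; rewrite /bspline_coefs.
case: (k =P 0%N) => k0; case: (k =P n.*2.+1) => k1; rewrite /=;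
  do ?[case: eqP => ? /=]; do ?[case: ifP => ? /=]; do ?[case: eqP => ? /=];
  by [|exfalso; lia].
Qed.

Lemma sum_delta {R : realType} (c : nat -> R) (m l : nat) (F : nat -> R) :
  (l < m)%N -> (forall k, (k < m)%N -> F k = (k == l)%:R) ->
  \sum_(k < m) c k * F k = c l.
Proof.
move=> lm FE; rewrite (bigD1 (Ordinal lm))//= FE// eqxx mulr1.
rewrite big1 ?addr0// => k; rewrite -val_eqE /= => /negPf kl.
by rewrite FE// kl mulr0.
Qed.

(** The two inner B-coefficients of g on an interval are the values at eta and xi
    of its tangents at the ends of that interval; g being C1, the derivative at
    a knot is the same from both sides. *)
Lemma spline_gammaE {R : realType} (n : nat) (a b : R) (x beta : nat -> R)
    (B : nat -> R -> R) (gamma : nat -> R) (g : R -> R) :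
  let g' := derive_on `[a, b] g in
  (1 <= n)%N -> is_partition a b n x ->
  (forall k, (k < n.*2.+2)%N -> is_bspline n x beta k (B k)) ->
  GS2 a b n x beta g ->
  (forall t, t \in `[a, b] -> g t = \sum_(k < n.*2.+2) gamma k * B k t) ->
  [/\ gamma 0%N = g a, gamma n.*2.+1 = g b &
      forall i, (i < n)%N ->
        let d := theta beta i.+1 * (x i.+1 - x i) in
        gamma i.*2.+1 = g (x i) + d * g' (x i) /\
        gamma i.+1.*2 = g (x i.+1) - d * g' (x i.+1)].
Proof.
move=> g' n1 xP BP [[gD _] _] gE.
have coefE i j l : (i < n)%N -> (l < n.*2.+2)%N ->
    (forall k, (k < n.*2.+2)%N ->
       nth 0 (bspline_coefs n x beta k i.+1) j = (k == l)%:R) ->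
    gamma l = nth 0 (bcoefs (theta beta i.+1) (x i) (x i.+1) g) j.
  move=> ni ln lP; have [xx ax xb] := partition_le xP ni.
  have i1 : (1 <= i.+1 <= n)%N by [].
  rewrite (bcoefs_sum (c := gamma) (F := B) (m := n.*2.+2) _ _ xx).
  - rewrite -(sum_delta gamma ln lP).
    by apply: eq_bigr => k _; have [_ <-] := BP k (ltn_ord k) _ i1.
  - move=> s; rewrite in_itv/= => /andP[xs sx]; apply: gE.
    by rewrite in_itv/= (le_trans ax xs) (le_trans sx xb).
  - by move=> k kn; have [[[BD _] _] _] := BP k kn _ i1.
have g'E i t : (i < n)%N -> t \in `[x i, x i.+1] ->
    derive_on `[x i, x i.+1] g t = g' t.
  move=> ni tI; have [xx ax xb] := partition_le xP ni.
  apply: derive_on_subE => //; apply: gD; move: tI.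
  by rewrite !in_itv/= => /andP[xt tx]; rewrite (le_trans ax xt) (le_trans tx xb).
have [x0 xn _] := xP.
split=> [||i ni].
- rewrite (coefE 0%N 0%N)//= ?x0// => k kn.
  by have [] := bspline_coefs_ends x beta n1 kn.
- rewrite (coefE n.-1 3%N)//= ?prednK ?xn// => k kn.
  by have [] := bspline_coefs_ends x beta n1 kn.
- have [xx _ _] := partition_le xP ni.
  have xI : x i \in `[x i, x i.+1] by rewrite in_itv/= lexx ltW.
  have xI' : x i.+1 \in `[x i, x i.+1] by rewrite in_itv/= lexx ltW.
  have inner k kn := @bspline_coefs_inner _ n x beta k i ni kn.
  split.
    rewrite (coefE i 1%N)//= ?g'E// => [|k kn]; first lia.
    by have [] := inner k kn.
  rewrite (coefE i 2%N)//= ?g'E// => [|k kn]; first lia.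
  by have [] := inner k kn.
Qed.

Definition scp_node {R : realType} (n : nat) (x beta : nat -> R) (k : nat) : R :=
  if odd k then eta n x beta k./2 else xi x beta k./2.

Lemma scp_node_even {R : realType} (n : nat) (x beta : nat -> R) (i : nat) :
  scp_node n x beta i.*2 = xi x beta i.
Proof. by rewrite /scp_node odd_double doubleK. Qed.

Lemma scp_node_odd {R : realType} (n : nat) (x beta : nat -> R) (i : nat) :
  scp_node n x beta i.*2.+1 = eta n x beta i.
Proof. by rewrite /scp_node /= odd_double uphalf_double. Qed.

Lemma scpE {R : realType} (n : nat) (x beta gamma : nat -> R) :
  scp n x beta gamma = polygon (scp_node n x beta) gamma 0 n.*2.+1.
Proof.
rewrite /scp /polygon /scp_vertices -doubleS; congr polygonal.
rewrite -[X in iota X _.*2]double0; elim: n.+1 0%N => [//|m IH] j.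
by rewrite doubleS /= -doubleS -IH scp_node_odd scp_node_even.
Qed.

(** The offsets theta_i h_i are at most a quarter of h_i, so the two vertices
    inside an interval do not cross. *)
Lemma scp_node_lt {R : realType} (n : nat) (a b : R) (x beta : nat -> R) :
  (1 <= n)%N -> is_partition a b n x -> (forall i, (1 <= i <= n)%N -> -1 <= beta i < 0) ->
  forall k, (k < n.*2.+1)%N -> scp_node n x beta k < scp_node n x beta k.+1.
Proof.
move=> n1 [_ _ xS] betaP.
have d0 i : (i < n)%N ->
    0 < theta beta i.+1 * step x i.+1 < (x i.+1 - x i) / 2.
  move=> ni; have /andP[th0 th4] := theta_bounds (betaP i.+1 ni).
  have := xS i ni; rewrite /step /= => xx; apply/andP; split; nra.
move=> k kn; rewrite -[k]odd_double_half.
have [i in_] : exists2 i, k./2 = i & (i <= n)%N by exists k./2 => //; lia.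
case: (boolP (odd k)) => kodd; rewrite ?add0n ?add1n in_ => i_n.
  have {}i_n : (i < n)%N by lia.
  rewrite -doubleS scp_node_even scp_node_odd /xi /eta /= ltn_eqF//.
  have := d0 i i_n; lra.
rewrite scp_node_even scp_node_odd /xi /eta.
(* At an end of the partition only one of the two offsets is present. *)
case: (i =P 0%N) => [i0|i0]; case: (i =P n) => [iN|iN]; first lia.
- have i_n' : (i < n)%N by lia.
  by have := d0 i i_n'; rewrite i0; lra.
- have i_n' : (i.-1 < n)%N by lia.
  have := d0 i.-1 i_n'; rewrite prednK ?lt0n; last exact/eqP.
  by rewrite -iN; lra.
- have i_n1 : (i < n)%N by lia.
  have i_n2 : (i.-1 < n)%N by lia.
  have := d0 i i_n1; have := d0 i.-1 i_n2; rewrite prednK ?lt0n; last exact/eqP.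
  lra.
Qed.

(** At an inner knot, the two neighbouring vertices lie on one tangent.  At an end
    of I one of them is the end point of the graph of g itself. *)
Lemma scp_slopeE {R : realType} (n : nat) (a b : R) (x beta : nat -> R)
    (B : nat -> R -> R) (gamma : nat -> R) (g : R -> R) :
  let g' := derive_on `[a, b] g in
  let sl := polygon_slope (scp_node n x beta) gamma in
  (1 <= n)%N -> is_partition a b n x ->
  (forall i, (1 <= i <= n)%N -> -1 <= beta i < 0) ->
  (forall k, (k < n.*2.+2)%N -> is_bspline n x beta k (B k)) ->
  GS2 a b n x beta g ->
  (forall t, t \in `[a, b] -> g t = \sum_(k < n.*2.+2) gamma k * B k t) ->
  (forall i, (i <= n)%N -> sl i.*2 = g' (x i)) /\
  (forall i, (i < n)%N -> sl i.*2.+1 = g' ((x i + x i.+1) / 2)).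
Proof.
move=> g' sl n1 xP betaP BP gG gE.
have [c0 cN cE] := spline_gammaE n1 xP BP gG gE; rewrite -/g' in cE.
have nodeS := scp_node_lt n1 xP betaP.
have [x0 xn xS] := xP.
split=> i ni; rewrite /sl /polygon_slope.
  have /nodeS : (i.*2 < n.*2.+1)%N by lia.
  rewrite -subr_gt0 => /lt0r_neq0 hne; apply: (mulIf hne); rewrite divfK// {hne}.
  rewrite scp_node_even scp_node_odd /xi /eta.
  case: (i =P 0%N) => [i0|i0]; case: (i =P n) => [iN|iN]; first lia.
  - have i_n' : (i < n)%N by lia.
    have [-> _] := cE i i_n'; rewrite i0 double0 c0 -x0 /step /=; ring.
  - have i_n' : (i.-1 < n)%N by lia.
    have := (cE i.-1 i_n').2; rewrite prednK ?lt0n; last exact/eqP.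
    move=> ->; rewrite iN cN -xn /step; ring.
  - have i_n1 : (i < n)%N by lia.
    have i_n2 : (i.-1 < n)%N by lia.
    have := (cE i.-1 i_n2).2; rewrite prednK ?lt0n; last exact/eqP.
    move=> ->; have [-> _] := cE i i_n1; rewrite /step /=; ring.
have [xx ax xb] := partition_le xP ni.
have [_ /(_ i.+1 ni)/= [_ gM]] := gG.
have gD t : t \in `[x i, x i.+1] ->
    derive_on `[x i, x i.+1] g t = g' t.
  move=> tI; apply: derive_on_subE => //; apply: gG.1.1; move: tI.
  by rewrite !in_itv/= => /andP[xt tx]; rewrite (le_trans ax xt) (le_trans tx xb).
have [_] := gM _ _ (dyadic_full _ _).
have mI : (x i + x i.+1) / 2 \in `[x i, x i.+1].
  by rewrite in_itv/=; apply/andP; split; lra.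
rewrite !gD ?mI ?in_itv/= ?lexx ?ltW// => ->; have [-> _] := cE i ni; have [_ ->] := cE i ni.
rewrite -doubleS scp_node_even scp_node_odd /xi /eta /= ltn_eqF// /step /=.
have /andP[th0 th4] := theta_bounds (betaP i.+1 ni).
set th := theta beta i.+1 in th0 th4 *.
have th1 : 1 - 2 * th != 0 by apply: lt0r_neq0; lra.
have h0 : x i.+1 - x i != 0 by rewrite subr_eq0 gt_eqF.
have -> : x i.+1 - th * (x i.+1 - x i) - (x i + th * (x i.+1 - x i)) =
  (1 - 2 * th) * (x i.+1 - x i) by ring.
by field; rewrite ?th1 ?h0.
Qed.

(** The three slopes on one interval are its derivatives at both ends and at the
    midpoint, which is what [merrien_derive_in] asks for. *)
Lemma spline_derive_inP {R : realType} (n : nat) (a b : R) (x beta : nat -> R)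
    (g : R -> R) (A : set R) (sl : nat -> R) :
  let g' := derive_on `[a, b] g in
  (1 <= n)%N -> is_partition a b n x ->
  (forall i, (1 <= i <= n)%N -> -1 <= beta i < 0) ->
  GS2 a b n x beta g ->
  (forall i, (i <= n)%N -> sl i.*2 = g' (x i)) ->
  (forall i, (i < n)%N -> sl i.*2.+1 = g' ((x i + x i.+1) / 2)) ->
  is_interval A -> closed A ->
  (forall t, t \in `[a, b] -> A (g' t)) <->
  (forall k, (k < n.*2.+1)%N -> A (sl k)).
Proof.
move=> g' n1 xP betaP [[gD _] gM] sl0 sl1 iA cA.
have xI i : (i <= n)%N -> x i \in `[a, b].
  have [<- <- xS] := xP; have xM := nodes_le (nodes_lt xS).
  by move=> ni; rewrite in_itv/= !xM//; lia.
split=> [gA k kn|sA t tab].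
  rewrite -[k]odd_double_half; have kn' : (k./2 <= n)%N by lia.
  case: (boolP (odd k)) => kodd; rewrite ?add0n ?add1n; last first.
    by rewrite sl0//; apply/gA/xI.
  have {}kn' : (k./2 < n)%N by lia.
  rewrite sl1//; apply: gA; have [xx ax xb] := partition_le xP kn'.
  by rewrite in_itv/=; apply/andP; split; lra.
have [i ni tI] : exists2 i, (i < n)%N & x i <= t <= x i.+1.
  by apply: nodes_cover => //; have [-> -> _] := xP; move: tab; rewrite in_itv.
have [xx ax xb] := partition_le xP ni.
have g'E r : x i <= r <= x i.+1 -> derive_on `[x i, x i.+1] g r = g' r.
  move=> /andP[xr rx]; apply: derive_on_subE; rewrite ?in_itv/= ?xr//.
  by apply: gD; rewrite in_itv/= (le_trans ax xr) (le_trans rx xb).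
rewrite -g'E//.
have := gM i.+1 ni; have := theta_bounds (betaP i.+1 ni) => th04 gV.
apply: (merrien_derive_in iA cA th04 xx gV (dyadic_full _ _) _ _ _ tI).
- by rewrite g'E ?lexx ?ltW// -sl0; [apply: sA; lia|exact: ltnW].
- by rewrite g'E; [rewrite -sl1//; apply: sA; lia|apply/andP; split; lra].
- by rewrite g'E ?lexx ?ltW// -sl0//; apply: sA; lia.
Qed.

(** Monotonicity of g' on each interval comes from [merrien_derive_ndecr]; two
    arguments in different intervals are compared through a knot between them. *)
Lemma spline_derive_ndecrP {R : realType} (n : nat) (a b : R) (x beta : nat -> R)
    (g : R -> R) (sl : nat -> R) :
  let g' := derive_on `[a, b] g in
  (1 <= n)%N -> is_partition a b n x ->
  (forall i, (1 <= i <= n)%N -> -1 <= beta i < 0) ->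
  GS2 a b n x beta g ->
  (forall i, (i <= n)%N -> sl i.*2 = g' (x i)) ->
  (forall i, (i < n)%N -> sl i.*2.+1 = g' ((x i + x i.+1) / 2)) ->
  (forall s t, a <= s -> s < t -> t <= b -> g' s <= g' t) <->
  (forall k, (k.+1 < n.*2.+1)%N -> sl k <= sl k.+1).
Proof.
move=> g' n1 xP betaP [[gD _] gM] sl0 sl1; split=> [gA k kn|sA].
  rewrite -[k]odd_double_half; have kn' : (k./2 < n)%N by lia.
  have [xx ax xb] := partition_le xP kn'.
  case: (boolP (odd k)) => kodd; rewrite ?add0n ?add1n.
    by rewrite sl1// -doubleS sl0//; apply: gA; lra.
  by rewrite sl1// sl0; [apply: gA; lra|exact: ltnW].
have piece i : (i < n)%N ->
    forall s t, x i <= s -> s <= t -> t <= x i.+1 -> g' s <= g' t.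
  move=> ni s t xs; rewrite le_eqVlt => /predU1P[->//|st] tx.
  have [xx ax xb] := partition_le xP ni.
  have g'E r : x i <= r <= x i.+1 -> derive_on `[x i, x i.+1] g r = g' r.
    move=> /andP[xr rx]; apply: derive_on_subE; rewrite ?in_itv/= ?xr//.
    by apply: gD; rewrite in_itv/= (le_trans ax xr) (le_trans rx xb).
  rewrite -!g'E ?xs ?tx ?(ltW (le_lt_trans xs st)) ?(ltW (lt_le_trans st tx))//.
  have th04 := theta_bounds (betaP i.+1 ni).
  apply: (merrien_derive_ndecr th04 xx (gM i.+1 ni)) => //.
  rewrite !g'E ?lexx ?(ltW xx)//; last by apply/andP; split; lra.
  rewrite -sl1// -sl0; last exact: ltnW.
  by rewrite -sl0// doubleS !sA//; lia.
have [x0 xn xS] := xP; have xM := nodes_le (nodes_lt xS).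
suff H m : (m <= n)%N ->
    forall s t, x 0%N <= s -> s <= t -> t <= x m -> g' s <= g' t.
  move=> s t as_ st tb; apply: (H n) => //; rewrite ?x0 ?xn//; exact: ltW.
elim: m => [_ s t h1 h2 h3|m IH mn s t as_ st tm].
  by have -> : s = t by lra.
have [tm'|mt] := leP t (x m); first by apply: IH => //; exact: ltnW.
have [ms|sm] := leP (x m) s; first exact: (piece m).
apply: (@le_trans _ _ (g' (x m))).
  by apply: IH; rewrite ?(ltW sm)//; exact: ltnW.
by apply: (piece m); rewrite ?lexx ?(ltW mt).
Qed.

Theorem theorem2 (R : realType) (n : nat) (a b : R) (x beta : nat -> R)
    (B : nat -> R -> R) (gamma : nat -> R) (g : R -> R)
    (n_ge1 : (1 <= n)%N)
    (x_part : is_partition a b n x)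
    (beta_bnd : forall i, (1 <= i <= n)%N -> -1 <= beta i < 0)
    (B_bspline : forall k, (k < n.*2.+2)%N -> is_bspline n x beta k (B k))
    (g_GS2 : GS2 a b n x beta g)
    (g_sum : forall t, t \in `[a, b] -> g t = \sum_(k < n.*2.+2) gamma k * B k t) :
  [/\ {in `[a, b] &, {homo g : s t / s <= t}} <->
        {in `[a, b] &, {homo scp n x beta gamma : s t / s <= t}},
      {in `[a, b] &, {homo g : s t /~ s <= t}} <->
        {in `[a, b] &, {homo scp n x beta gamma : s t /~ s <= t}} &
      convex_on a b g <-> convex_on a b (scp n x beta gamma)].
Proof.
have ab : a < b.
  by have [<- <- xS] := x_part; apply: (nodes_lt xS); rewrite n_ge1 leqnn.
have gD : {in `[a, b], forall t, derivable_on `[a, b] g t} by have [[]] := g_GS2.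
have [sl0 sl1] := scp_slopeE n_ge1 x_part beta_bnd B_bspline g_GS2 g_sum.
have nodeM := nodes_lt (scp_node_lt n_ge1 x_part beta_bnd).
have [node0 nodeN] : scp_node n x beta 0 = a /\ scp_node n x beta n.*2.+1 = b.
  by have [<- <- _] := x_part; rewrite scp_node_odd /eta eqxx.
have secE (A : set R) : is_interval A -> closed A ->
    secants_in A a b g <-> secants_in A a b (scp n x beta gamma).
  move=> iA cA; rewrite scpE (derive_on_secants_inP cA ab gD).
  rewrite (spline_derive_inP n_ge1 x_part beta_bnd g_GS2 sl0 sl1 iA cA).
  by rewrite -(polygon_secants_inP gamma iA nodeM) node0 nodeN.
split.
- rewrite !homo_leP; apply: secE; first exact: interval_is_interval.
  exact: rray_closed.
- rewrite !nhomo_leP; apply: secE; first exact: interval_is_interval.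
  exact: lray_closed.
- rewrite !convex_onP scpE (derive_on_secants_ndecrP gD).
  rewrite (spline_derive_ndecrP n_ge1 x_part beta_bnd g_GS2 sl0 sl1).
  by rewrite -(polygon_secants_ndecrP gamma nodeM) node0 nodeN.
Qed.
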